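(* Let $n\ge 2$ be an integer with prime decomposition $n=p_1^{y_1}\cdots p_r^{y_r}$ (the $p_i$ pairwise distinct primes, $y_i\ge 1$) and let $$\Gamma_n=\langle a,t_1,\dots,t_r\mid t_it_j=t_jt_i\ (i\ne j),\ t_iat_i^{-1}=a^{p_i^{y_i}}\ (i=1,\dots,r)\rangle.$$ Let $H$ be a finite index subgroup of $\Gamma_n$, written as $$H=\langle t_1^{k_{11}}t_2^{k_{12}}\cdots t_r^{k_{1r}}a^{l_1},\ t_2^{k_{22}}\cdots t_r^{k_{2r}}a^{l_2},\ \dots,\ t_r^{k_{rr}}a^{l_r},\ a^m\rangle$$ for integers $k_{ii}>0$, $k_{ij}\ge 0$ ($i<j$), $l_i\in\mathbb{Z}$ and an integer $m>0$ such that $\gcd(m,n)=1$ and $H\cap\langle a\rangle=\langle a^m\rangle$. Then $H$ has the presentation $$H\simeq\langle \alpha,x_1,\dots,x_r\mid x_i\alpha x_i^{-1}=\alpha^{P_i},\ x_ix_jx_i^{-1}x_j^{-1}=\alpha^{R_{ij}}\ (1\le i,j\le r)\rangle,$$ where $P_i=p_i^{y_ik_{ii}}p_{i+1}^{y_{i+1}k_{i,i+1}}\cdots p_r^{y_rk_{ir}}$ for $i=1,\dots,r$ and the $R_{ij}\in\mathbb{Z}$ are characterized by $$l_iP_i(1-P_j)-l_jP_j(1-P_i)=R_{ij}m.$$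
   Context: Every finite index subgroup of $\Gamma_n$ can be written in the displayed form. Part of the assertion is that the integers $R_{ij}$ satisfying the characterizing equation exist. *)

(* Defs.v *)
From HB Require Import structures.
From mathcomp Require Import all_boot all_algebra.
From mathcomp Require Import boolp classical_sets cardinality.

Set Implicit Arguments.
Unset Strict Implicit.
Unset Printing Implicit Defensive.

Local Open Scope group_scope.
Local Open Scope classical_set_scope.

(* Unreduced words: the letter (x, false) is x and (x, true) is x^-1. Words
   carry the raw operations only (a [baseGroupType]); no group law holds before
   taking the quotient. *)
Definition word (X : Type) := seq (X * bool).

HB.instance Definition _ (X : choiceType) := Choice.on (word X).

Section Word.
Variable X : Type.

Definition word_mul (u v : word X) : word X := u ++ v.
Definition word_one : word X := [::].
Definition word_inv (u : word X) : word X := rev [seq (c.1, ~~ c.2) | c <- u].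

HB.instance Definition _ := hasMul.Build (word X) word_mul.
HB.instance Definition _ := hasOne.Build (word X) word_one.
HB.instance Definition _ := hasInv.Build (word X) word_inv.

Definition letter (x : X) : word X := [:: (x, false)].

End Word.

Section Presented.
Variables (X : choiceType) (rels : word X -> word X -> Prop).

(* Equality in the group < X | u = v for all u, v with rels u v >. *)
Inductive derivable : word X -> word X -> Prop :=
| derivable_refl u : derivable u u
| derivable_sym u v : derivable u v -> derivable v u
| derivable_trans v u w : derivable u v -> derivable v w -> derivable u w
| derivable_mul u u' v v' :
    derivable u u' -> derivable v v' -> derivable (u * v) (u' * v')
| derivable_cancel x b : derivable [:: (x, b); (x, ~~ b)] 1
| derivable_rel u v : rels u v -> derivable u v.

Definition derivableb : rel (word X) := fun u v => `[< derivable u v >].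

Lemma derivableb_refl : reflexive derivableb.
Proof. by move=> u; apply/asboolP; exact: derivable_refl. Qed.

Lemma derivableb_sym : symmetric derivableb.
Proof.
by move=> u v; apply/asboolP/asboolP; exact: derivable_sym.
Qed.

Lemma derivableb_trans : transitive derivableb.
Proof.
by move=> v u w /asboolP uv /asboolP vw; apply/asboolP; exact: derivable_trans uv vw.
Qed.

Canonical derivable_equiv :=
  EquivRel derivableb derivableb_refl derivableb_sym derivableb_trans.

Local Open Scope quotient_scope.

Definition presented := {eq_quot derivable_equiv}.

HB.instance Definition _ := Choice.on presented.
HB.instance Definition _ := EqQuotient.on presented.

Definition pres_pi (u : word X) : presented := \pi_presented u.

Lemma pres_piP u v : pres_pi u = pres_pi v <-> derivable u v.
Proof.
split=> [/eqP|uv]; first by rewrite eqmodE => /asboolP.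
by apply/eqP; rewrite eqmodE; apply/asboolP.
Qed.

Lemma derivable_repr u : derivable (repr (pres_pi u)) u.
Proof. by apply/pres_piP; rewrite /pres_pi reprK. Qed.

Lemma derivable_mulV (u : word X) : derivable (u * u^-1) 1.
Proof.
elim: u => [|[x b] u IHu]; first exact: derivable_refl.
have e : word_mul ((x, b) :: u) (word_inv ((x, b) :: u)) =
    word_mul [:: (x, b)] (word_mul (word_mul u (word_inv u)) [:: (x, ~~ b)]).
  by rewrite /word_mul /word_inv /= rev_cons -cats1 catA.
rewrite -[_ / _]/(word_mul _ (word_inv _)) e.
apply: derivable_trans (derivable_cancel x b).
apply: (@derivable_mul [:: (x, b)] [:: (x, b)] _ [:: (x, ~~ b)]).
  exact: derivable_refl.
apply: (@derivable_mul _ [::] [:: (x, ~~ b)] [:: (x, ~~ b)] IHu).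
exact: derivable_refl.
Qed.

Lemma word_invK : involutive (@word_inv X).
Proof.
move=> u; rewrite /word_inv -map_rev revK -map_comp -[RHS]map_id.
by apply: eq_map => -[x b] /=; rewrite negbK.
Qed.

Lemma derivable_mulVw (u : word X) : derivable (u^-1 * u) 1.
Proof. have := derivable_mulV (word_inv u).
by rewrite -[_ / _]/(word_mul _ (word_inv (word_inv u))) word_invK. Qed.

Definition pres_mul (p q : presented) : presented := pres_pi (repr p * repr q).
Definition pres_one : presented := pres_pi 1.
Definition pres_inv (p : presented) : presented := pres_pi (repr p)^-1.

Lemma pres_mulE u v : pres_mul (pres_pi u) (pres_pi v) = pres_pi (u * v).
Proof. by apply/pres_piP; apply: derivable_mul; exact: derivable_repr. Qed.

Lemma pres_reprK (p : presented) : pres_pi (repr p) = p.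
Proof. exact: reprK. Qed.

Lemma pres_mulA : associative pres_mul.
Proof.
move=> p q s; rewrite -[p]pres_reprK -[q]pres_reprK -[s]pres_reprK.
rewrite !pres_mulE; congr pres_pi; exact: catA.
Qed.

Lemma pres_mul1 : left_id pres_one pres_mul.
Proof. by move=> p; rewrite -[p]pres_reprK pres_mulE. Qed.

Lemma pres_mulr1 : right_id pres_one pres_mul.
Proof.
move=> p; rewrite -[p]pres_reprK pres_mulE; congr pres_pi; exact: cats0.
Qed.

Lemma pres_mulV : left_inverse pres_one pres_inv pres_mul.
Proof.
move=> p; rewrite -{2}[p]pres_reprK pres_mulE; apply/pres_piP.
exact: derivable_mulVw.
Qed.

Lemma pres_mulrV : right_inverse pres_one pres_inv pres_mul.
Proof.
move=> p; rewrite -{1}[p]pres_reprK pres_mulE; apply/pres_piP.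
exact: derivable_mulV.
Qed.

HB.instance Definition _ := isGroup.Build presented
  pres_mulA pres_mul1 pres_mulr1 pres_mulV pres_mulrV.

Definition pres_gen (x : X) : presented := pres_pi (letter x).

End Presented.

Section Groups.
Variable G : groupType.

Definition generated (S : set G) : set G :=
  smallest [set A : set G | group_closed (mem A)] S.

Definition lcoset (H : groupClosed G) (x : G) : set G :=
  [set (x * h)%g | h in [set` H]].

Definition finite_index (H : groupClosed G) := finite_set (range (lcoset H)).

Definition subgroup (H : groupClosed G) := {x : G | x \in H}.

Lemma subgroup_closed (H : groupClosed G) : group_closed (fun x : G => x \in H).
Proof. by split=> [|u v]; [exact: gpred1 | exact: gpredF]. Qed.

HB.instance Definition _ (H : groupClosed G) := SubChoice.on (subgroup H).
HB.instance Definition _ (H : groupClosed G) :=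
  SubChoice_isSubGroup.Build G _ (subgroup H) (subgroup_closed H).

End Groups.

Definition isomorphic (G K : groupType) :=
  exists f : {multiplicative G -> K}, bijective f.

Definition expgz (G : baseGroupType) (x : G) (z : int) : G :=
  match z with Posz n => x ^+ n | Negz n => x ^- n.+1 end.

Section Gamma.
Variables (r : nat) (p y : 'I_r -> nat).

(* In both presentations below the generator a (resp. alpha) is [None] and the
   generator t_i (resp. x_i) is [Some i]. *)
Inductive Gamma_rel : word (option 'I_r) -> word (option 'I_r) -> Prop :=
| Gamma_rel_comm (i j : 'I_r) : i != j ->
    Gamma_rel (letter (Some i) * letter (Some j))
              (letter (Some j) * letter (Some i))
| Gamma_rel_conj (i : 'I_r) :
    Gamma_rel (letter (Some i) * letter None * (letter (Some i))^-1)
              (letter None ^+ (p i ^ y i)%N).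

Definition Gamma := presented Gamma_rel.
HB.instance Definition _ := Group.on Gamma.

Definition Gamma_a : Gamma := pres_gen Gamma_rel None.
Definition Gamma_t (i : 'I_r) : Gamma := pres_gen Gamma_rel (Some i).

End Gamma.

Section SubgroupPresentation.
Variables (r : nat) (P : 'I_r -> nat) (R : 'I_r -> 'I_r -> int).

Inductive sub_rel : word (option 'I_r) -> word (option 'I_r) -> Prop :=
| sub_rel_conj (i : 'I_r) :
    sub_rel (letter (Some i) * letter None * (letter (Some i))^-1)
            (letter None ^+ P i)
| sub_rel_comm (i j : 'I_r) :
    sub_rel (letter (Some i) * letter (Some j) *
             (letter (Some i))^-1 * (letter (Some j))^-1)
            (expgz (letter None) (R i j)).

End SubgroupPresentation.

(* Main.v *)
From HB Require Import structures.
Require Import Defs.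
From mathcomp Require Import all_boot all_order all_algebra.
From mathcomp Require Import boolp classical_sets cardinality.
From mathcomp Require Import ring.

(** The relation [t_i a t_i^-1 = a^q_i], with [q_i = p_i ^ y_i], lets [Gamma]
    act on the line by affine maps: [a] is the translation by 1 and [t_i] the
    dilation by [q_i]. Put [T_i] for the product of the [t_j ^ k_ij], [j >= i],
    so that the given generator [x_i = T_i a^l_i] acts as
    [s |-> P_i s + P_i l_i]. The commutator of [x_i] and [x_j] is then the
    translation by [c_ij = l_i P_i (1 - P_j) - l_j P_j (1 - P_i)], and
    [x_i x_j = a^c_ij x_j x_i] already follows from the relations
    ([translation_commutator]).

    Existence of [R]: [a^c_ij] lies in [H] and in [<a>], hence in [<a^m>], and
    since [a] has infinite order ([Gamma_a_inj]) [m] divides [c_ij].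

    Presentation: given [R], the elements [a^m] and [x_i] satisfy the relations
    of the presented group [K], which gives a homomorphism [K -> Gamma] whose
    image is generated by these elements, that is, [H]. Only injectivity
    remains. In [K] a generator [x_i] can be moved to the right across powers of
    [alpha], and positive words in the [x_i] commute up to a power of [alpha] on
    their left, so every element is a fraction [u^-1 alpha^z v] with [u] and [v]
    positive words ([sub_fraction]). If its image is trivial, then [u] and [v]
    have the same exponent sums in every [t_j]; the matrix [k] being triangular
    with nonzero diagonal, each [x_i] occurs equally often in [u] and in [v]
    ([perm_eq_triangular]). Hence [u] and [v] agree up to a power of [alpha], the
    fraction is a conjugate of some [alpha^d], and [d = 0] because [a^m] has
    infinite order. *)

Set Implicit Arguments.
Unset Strict Implicit.
Unset Printing Implicit Defensive.

Import GRing.Theory Num.Theory.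
Local Open Scope group_scope.
Local Open Scope classical_set_scope.

(** * Integer powers in a group *)

Section IntegerPowers.
Variable G : groupType.
Implicit Types (x y g : G) (a b : int).

Lemma expgzS x a : expgz x (a + 1)%R = expgz x a * x.
Proof.
case: a => [n|[|n]].
- by rewrite -PoszD addn1 /= expgSr.
- by rewrite /= mulVg.
- have -> : (Negz n.+1 + 1 = Negz n :> int)%R by rewrite !NegzE; ring.
  by rewrite /expgz [x ^+ n.+2]expgS invgM mulgVK.
Qed.

Lemma expgzB1 x a : expgz x (a - 1)%R = expgz x a * x^-1.
Proof. by rewrite -[a in RHS](subrK 1%R) expgzS mulgK. Qed.

Lemma expgzD x a b : expgz x (a + b)%R = expgz x a * expgz x b.
Proof.
elim/int_rect: b => [|n IHn|n IHn]; first by rewrite addr0 mulg1.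
  by rewrite intS [(1 + _)%R]addrC addrA !expgzS IHn mulgA.
have -> : (- (n.+1%:Z) = - n%:Z - 1)%R by rewrite intS; ring.
by rewrite addrA !expgzB1 IHn mulgA.
Qed.

Lemma expgzN x a : expgz x (- a)%R = (expgz x a)^-1.
Proof. by apply: (mulgI (expgz x a)); rewrite -expgzD subrr mulgV. Qed.

Lemma expgzM x a b : expgz x (a * b)%R = expgz (expgz x a) b.
Proof.
elim/int_rect: b => [|n IHn|n IHn]; first by rewrite mulr0.
  by rewrite intS addrC mulrDr mulr1 expgzS expgzD IHn.
have -> : (- (n.+1%:Z) = - n%:Z - 1)%R by rewrite intS; ring.
by rewrite mulrBr mulr1 expgzB1 expgzD IHn [expgz x (- a)%R]expgzN.
Qed.

Lemma expgz_conj g x y a : g * x = y * g -> g * expgz x a = expgz y a * g.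
Proof.
move=> gx; have gxn n : g * x ^+ n = y ^+ n * g.
  elim: n => [|n IHn]; first by rewrite !expg0 mulg1 mul1g.
  by rewrite !expgS mulgA gx -mulgA IHn mulgA.
case: a => n //=; apply: (mulIg (x ^+ n.+1)).
by rewrite mulgVK -mulgA gxn mulKg.
Qed.

Lemma expgz_cycle x : generated [set x] `<=` range (expgz x).
Proof.
apply: smallest_sub => [|_ ->]; last by exists 1%R.
split=> [|u v]; rewrite !inE; first by exists 0%R.
by move=> [a _ <-] [b _ <-]; exists (a - b)%R; rewrite // expgzD expgzN.
Qed.

Lemma cycle_expgz x a : generated [set x] (expgz x a).
Proof.
move=> A [[A1 AB] xA]; apply: set_mem.
have {}xA : x \in A by rewrite inE; exact: xA.
have Agz := group_closedM (conj A1 AB); have AV := group_closedV (conj A1 AB).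
have An n : x ^+ n \in A.
  elim: n => [|n IHn]; first by [].
  by rewrite expgS; exact: Agz.
by case: a => n /=; [exact: An | exact: AV (An _)].
Qed.

End IntegerPowers.

Lemma gmulf_expgz (G K : groupType) (phi : UMagmaMorphism.type G K) x z :
  phi (expgz x z) = expgz (phi x) z.
Proof. by case: z => n; [exact: gmulfXn | exact: gmulfXVn]. Qed.

(** * Evaluating words, and homomorphisms out of a presented group *)

Section WordValue.
Variables (X : choiceType) (G : groupType) (f : X -> G).

Definition wordval (w : word X) : G :=
  \prod_(c <- w) (if c.2 then (f c.1)^-1 else f c.1).

Lemma wordval1 : wordval 1 = 1.
Proof. exact: big_nil. Qed.

Lemma wordvalM u v : wordval (u * v) = wordval u * wordval v.
Proof. exact: big_cat. Qed.

Lemma wordval_letter x : wordval (letter x) = f x.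
Proof. exact: big_seq1. Qed.

Lemma wordvalV u : wordval u^-1 = (wordval u)^-1.
Proof.
rewrite -[u^-1]/(word_inv u) /wordval.
elim: u => [|[x b] u IHu]; first by rewrite !big_nil invg1.
rewrite /word_inv /= rev_cons -cats1 big_cat /= big_seq1 IHu big_cons invgM.
by case: b; rewrite //= invgK.
Qed.

Lemma wordvalX u n : wordval (u ^+ n) = wordval u ^+ n.
Proof.
elim: n => [|[|n] IHn]; [exact: wordval1 | by rewrite !expg1 |].
by rewrite expgSS wordvalM IHn -expgS.
Qed.

Lemma wordval_expgz u z : wordval (expgz u z) = expgz (wordval u) z.
Proof. by case: z => n; rewrite /= ?wordvalV wordvalX. Qed.

Lemma derivable_wordval (rels : word X -> word X -> Prop) u v :
    (forall s t, rels s t -> wordval s = wordval t) ->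
  derivable rels u v -> wordval u = wordval v.
Proof.
move=> relsE; elim=> //.
- by move=> s t w _ -> _ ->.
- by move=> s s' t t' _ es _ et; rewrite !wordvalM es et.
- move=> x b; rewrite wordval1 /wordval !big_cons big_nil mulg1 /=.
  by case: b; rewrite /= ?mulgV ?mulVg.
Qed.

End WordValue.

Section Universal.
Variables (X : choiceType) (rels : word X -> word X -> Prop).
Notation gen := (pres_gen rels).

Lemma pres_piM u v : pres_pi rels (u * v) = pres_pi rels u * pres_pi rels v.
Proof. by rewrite -pres_mulE. Qed.

(** Relations hold between words, which have no group law; evaluating them on the
    generators turns them into identities in the presented group. *)
Lemma pres_piE w : pres_pi rels w = wordval gen w.
Proof.
elim: w => [|[x b] w IHw]; first by rewrite /wordval big_nil.
rewrite -[_ :: _]/(([:: (x, b)] : word X) * w) pres_piM IHw.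
rewrite /wordval big_cons; congr (_ * _).
case: b => //=; apply: (mulgI (gen x)); rewrite mulgV -pres_piM.
exact/pres_piP/(derivable_cancel rels x false).
Qed.

Lemma pres_rel u v : rels u v -> wordval gen u = wordval gen v.
Proof. by move=> uv; rewrite -!pres_piE; exact/pres_piP/derivable_rel. Qed.

Lemma pres_ind (A : presented rels -> Prop) :
    A 1 -> (forall x g, A g -> A (gen x * g)) ->
    (forall x g, A g -> A ((gen x)^-1 * g)) ->
  forall g, A g.
Proof.
move=> A1 Agen AgenV g; rewrite -[g]pres_reprK pres_piE /wordval.
elim: (repr g) => [|[x b] w IHw]; first by rewrite big_nil.
by rewrite big_cons; case: b; [exact: AgenV | exact: Agen].
Qed.

Lemma pres_hom (G : groupType) (f : X -> G) :
    (forall u v, rels u v -> wordval f u = wordval f v) ->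
  exists phi : UMagmaMorphism.type (presented rels) G,
    forall x, phi (gen x) = f x.
Proof.
move=> relsE; pose phi (g : presented rels) := wordval f (repr g).
have phiE u : phi (pres_pi rels u) = wordval f u.
  exact: derivable_wordval relsE (derivable_repr rels u).
have phiM : {morph phi : g h / g * h} by move=> g h; rewrite [LHS]phiE wordvalM.
have phi1 : phi 1 = 1 by rewrite [LHS]phiE wordval1.
pose phi_mixin := isUMagmaMorphism.Build _ _ phi (pair phi1 phiM).
pose Phi : UMagmaMorphism.type _ _ := HB.pack phi phi_mixin.
by exists Phi => x; rewrite [LHS]phiE wordval_letter.
Qed.

Lemma range_pres_hom (G : groupType)
    (phi : UMagmaMorphism.type (presented rels) G) :
  range phi = generated (range (phi \o gen)).
Proof.
apply/seteqP; split=> [_ [g _ <-] A [A_group genA]|].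
  apply: set_mem; have {}genA x : phi (gen x) \in A.
    by rewrite inE; apply: genA; exists x.
  have AM := group_closedM A_group; have AV := group_closedV A_group.
  elim/pres_ind: g => [|x g Ag|x g Ag].
  - by rewrite gmulf1; exact: A_group.1.
  - by rewrite (@gmulfM _ _ phi); exact: AM (genA x) Ag.
  - by rewrite (@gmulfM _ _ phi) gmulfV; exact: AM (AV _ (genA x)) Ag.
apply: smallest_sub => [|_ [x _ <-]]; last by exists (gen x).
split=> [|u v]; rewrite !inE; first by exists 1; rewrite ?gmulf1.
by move=> [g _ <-] [h _ <-]; exists (g / h); rewrite ?gmulfF.
Qed.

End Universal.

(** The isomorphism of the theorem is oriented from the subgroup to the
    presented group, whereas a presentation provides maps out of the latter;
    hence the inverse of [phi], built by choosing preimages. *)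
Lemma embedding_isomorphic (G K : groupType) (H : groupClosed G)
    (phi : UMagmaMorphism.type K G) :
  injective phi -> [set` H] = range phi -> isomorphic (subgroup H) K.
Proof.
move=> phi_inj phiH.
have ex (h : subgroup H) : exists g, phi g = val h.
  have [g _ gh] : range phi (val h) by rewrite -phiH; exact: (valP h).
  by exists g.
pose psi (h : subgroup H) : K := projT1 (cid (ex h)).
have psiK h : phi (psi h) = val h by exact: projT2 (cid (ex h)).
have psiM : {morph psi : g h / g * h}.
  by move=> g h; apply: phi_inj; rewrite gmulfM !psiK.
pose psi_mixin := isMultiplicative.Build _ _ psi psiM.
pose Psi : {multiplicative _ -> _} := HB.pack psi psi_mixin.
have phiP g : phi g \in H.
  have : [set` H] (phi g) by rewrite phiH; exists g.
  by [].
exists Psi; exists (fun g => Sub (phi g) (phiP g) : subgroup H) => [h|g].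
  by apply: val_inj; rewrite SubK psiK.
by apply: phi_inj; rewrite psiK SubK.
Qed.

(** * Positive words and fractions *)

(** The results below use only that conjugation by [x_i] raises [al] to a
    nonnegative power and that the [x_i] commute up to powers of [al]. *)
Section PositiveWords.
Variables (r : nat) (K : groupType) (al : K) (x : 'I_r -> K).
Variables (P : 'I_r -> nat) (R : 'I_r -> 'I_r -> int).
Hypothesis x_al : forall i, x i * al = expgz al (P i) * x i.
Hypothesis x_x : forall i j, x i * x j = expgz al (R i j) * (x j * x i).
Implicit Types u v : seq 'I_r.

Definition pos u : K := \prod_(i <- u) x i.

Lemma pos_cons i u : pos (i :: u) = x i * pos u.
Proof. exact: big_cons. Qed.

Lemma pos_cat u v : pos (u ++ v) = pos u * pos v.
Proof. exact: big_cat. Qed.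

Lemma gen_expgz i z : x i * expgz al z = expgz al ((P i)%:Z * z)%R * x i.
Proof. by rewrite expgzM; exact: expgz_conj. Qed.

Lemma pos_expgz u z :
  pos u * expgz al z = expgz al ((\prod_(i <- u) P i)%N%:Z * z)%R * pos u.
Proof.
elim: u => [|i u IHu]; first by rewrite /pos !big_nil mul1r mul1g mulg1.
rewrite pos_cons -mulgA IHu mulgA gen_expgz -mulgA; congr (expgz al _ * _).
by rewrite big_cons PoszM mulrA.
Qed.

Lemma gen_pos i u : exists d, x i * pos u = expgz al d * (pos u * x i).
Proof.
elim: u => [|j u [d IHu]]; first by exists 0%R; rewrite /pos big_nil !mul1g mulg1.
exists (R i j + (P j)%:Z * d)%R.
rewrite pos_cons mulgA x_x -!mulgA IHu [x j * (_ * _)]mulgA gen_expgz.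
by rewrite expgzD !mulgA.
Qed.

(** Only the order of the letters distinguishes [u] from [v], and each exchange
    of two adjacent letters costs a power of [al], which can be pushed to the
    left end across the letters before it. *)
Lemma pos_perm u v : perm_eq u v -> exists d, pos u = expgz al d * pos v.
Proof.
elim: u v => [|i u IHu] v uv.
  have /nilP -> : nilp v by rewrite /nilp -(perm_size uv).
  by exists 0%R; rewrite mul1g.
have iv : i \in v by rewrite -(perm_mem uv) mem_head.
case/splitPr: iv uv => v1 v2 uv.
have {}uv : perm_eq u (v1 ++ v2).
  by rewrite -(perm_cons i) (permPl uv) -cat1s perm_catCA.
have [d ue] := IHu _ uv; have [e xv1] := gen_pos i v1.
exists ((P i)%:Z * d + e)%R.
rewrite pos_cons ue mulgA gen_expgz expgzD -!mulgA; congr (_ * _).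
by rewrite !pos_cat pos_cons !mulgA xv1 !mulgA.
Qed.

Definition fraction u z v := (pos u)^-1 * expgz al z * pos v.

Lemma fraction_perm u z v : perm_eq u v ->
  exists d, fraction u z v = (pos v)^-1 * expgz al d * pos v.
Proof.
move=> /pos_perm [d uv]; exists (z - d)%R.
rewrite /fraction uv invgM -expgzN -!mulgA [expgz al (- d)%R * _]mulgA.
by rewrite -expgzD addrC.
Qed.

(** Fractions are stable under left multiplication by powers of [al], by the
    [x i] and by their inverses: a new [al] or [x i] is pushed to the right
    across [(pos u)^-1], and [(x i)^-1] is absorbed in the denominator. *)
Lemma expgz_fraction c u z v : exists d,
  expgz al c * fraction u z v = fraction u d v.
Proof.
exists ((\prod_(i <- u) P i)%N%:Z * c + z)%R; apply: (mulgI (pos u)).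
by rewrite /fraction !mulgA pos_expgz mulgV mul1g mulgK -expgzD.
Qed.

Lemma gen_fraction i u z v : exists d,
  x i * fraction u z v = fraction u d (i :: v).
Proof.
have [d xu] := gen_pos i u.
exists ((P i)%:Z * z - d)%R.
(* Multiplying by [al^d u] clears the denominator and turns the leading
   [x i] into [x i * pos u] by [xu]. *)
apply: (mulgI (expgz al d * pos u)).
rewrite -[in LHS]mulgA [pos u * (_ * _)]mulgA [LHS]mulgA -xu /fraction pos_cons.
rewrite !mulgA !mulgK -[x i * expgz _ _]/(x i * expgz al z) gen_expgz.
by rewrite -expgzD [(d + _)%R]addrC subrK.
Qed.

Lemma genV_fraction i u z v :
  (x i)^-1 * fraction u z v = fraction (rcons u i) z v.
Proof. by rewrite /fraction -cats1 pos_cat [pos [:: i]]big_seq1 invgM !mulgA. Qed.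

End PositiveWords.

Section Sub.
Variables (r : nat) (P : 'I_r -> nat) (R : 'I_r -> 'I_r -> int).

(** Naming the group structure keeps its operations in a single form, so that
    rewriting with lemmas on an abstract group applies. *)
Definition sub_pres : groupType := presented (sub_rel P R).
Definition sub_al : sub_pres := pres_gen (sub_rel P R) None.
Definition sub_x (i : 'I_r) : sub_pres := pres_gen (sub_rel P R) (Some i).

Lemma sub_x_al i : sub_x i * sub_al = expgz sub_al (P i) * sub_x i.
Proof.
have := pres_rel (sub_rel_conj P R i).
rewrite wordvalX !wordvalM wordvalV !wordval_letter => /= e.
by rewrite -e mulgVK.
Qed.

Lemma sub_x_x i j :
  sub_x i * sub_x j = expgz sub_al (R i j) * (sub_x j * sub_x i).
Proof.
have := pres_rel (sub_rel_comm P R i j).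
rewrite wordval_expgz !wordvalM !wordvalV !wordval_letter => e.
by rewrite -[expgz _ _]e !mulgA !mulgVK.
Qed.

Lemma sub_fraction (g : sub_pres) :
  exists u z v, g = fraction sub_al sub_x u z v.
Proof.
elim/pres_ind: g => [|[i|] g [u [z [v ->]]]|[i|] g [u [z [v ->]]]].
- exists [::], 0%R, [::]; by rewrite /fraction /pos !big_nil invg1 !mul1g.
- have [d e] := gen_fraction sub_x_al sub_x_x i u z v.
  by exists u, d, (i :: v).
- have [d e] := expgz_fraction sub_x_al 1 u z v.
  by exists u, d, v.
- by exists (rcons u i), z, v; rewrite -genV_fraction.
- have [d e] := expgz_fraction sub_x_al (-1) u z v.
  by exists u, d, v.
Qed.

End Sub.

(** * The affine model and the structure of Gamma *)

(** The semidirect product of [rat] by [Z^r], where the [i]-th basis vector acts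
    as multiplication by [q i]. The linear part is recorded by its exponents
    rather than by its ratio, so that the exponent sums of an element of [Gamma]
    can be read off without unique factorization. *)
Section Affine.
Variables (r : nat) (q : 'I_r -> nat).
Hypothesis q_gt0 : forall i, (0 < q i)%N.
Notation expo := {ffun 'I_r -> int}.
Implicit Types e f : expo.
Local Open Scope ring_scope.

Definition weight e : rat := \prod_i (q i)%:R ^ e i.

Lemma weight0 : weight 0 = 1.
Proof. by rewrite /weight big1 // => i _; rewrite ffunE. Qed.

Lemma weightD e f : weight (e + f) = weight e * weight f.
Proof.
rewrite /weight -big_split; apply: eq_bigr => i _.
by rewrite ffunE expfzDr // pnatr_eq0 -lt0n.
Qed.

Definition unit_expo (i : 'I_r) : expo := [ffun j => (i == j)%:R].

Lemma weight_unit i : weight (unit_expo i) = (q i)%:R.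
Proof.
rewrite /weight (bigD1 i) //= ffunE eqxx big1 ?mulr1 ?expr1z // => j.
by rewrite ffunE eq_sym => /negPf ->.
Qed.

(** The positivity proof is a parameter because the group laws depend on it. *)
Definition affine of (forall i, (0 < q i)%N) := (rat * expo)%type.
HB.instance Definition _ := Choice.on (affine q_gt0).

Definition affine_mul (s t : affine q_gt0) : affine q_gt0 :=
  (s.1 + weight s.2 * t.1, s.2 + t.2).
Definition affine_one : affine q_gt0 := (0, 0).
Definition affine_inv (s : affine q_gt0) : affine q_gt0 :=
  (- (weight (- s.2) * s.1), - s.2).

Lemma affine_mulA : associative affine_mul.
Proof.
move=> [a e] [b f] [c g]; congr (_, _) => /=; last exact: addrA.
by rewrite weightD; ring.
Qed.

Lemma affine_mul1 : left_id affine_one affine_mul.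
Proof. by move=> [a e]; congr (_, _); rewrite /= ?weight0 ?add0r ?mul1r. Qed.

Lemma affine_mulr1 : right_id affine_one affine_mul.
Proof. by move=> [a e]; congr (_, _); rewrite /= ?mulr0 ?addr0. Qed.

Lemma affine_mulV : left_inverse affine_one affine_inv affine_mul.
Proof. by move=> [a e]; congr (_, _); rewrite /= ?addNr. Qed.

Lemma affine_mulrV : right_inverse affine_one affine_inv affine_mul.
Proof.
move=> [a e]; congr (_, _); rewrite /= ?addrN //.
by rewrite mulrN mulrA -weightD subrr weight0 mul1r subrr.
Qed.

HB.instance Definition _ := isGroup.Build (affine q_gt0)
  affine_mulA affine_mul1 affine_mulr1 affine_mulV affine_mulrV.

Lemma affineM (s t : affine q_gt0) :
  (s * t)%g = (s.1 + weight s.2 * t.1, s.2 + t.2) :> affine q_gt0.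
Proof. by []. Qed.

Lemma affine_expgz (b : rat) z :
  expgz ((b, 0) : affine q_gt0) z = (b *~ z, 0) :> affine q_gt0.
Proof.
elim/int_rect: z => [//|n IHn|n IHn].
  by rewrite intS addrC expgzS IHn affineM /= weight0 mul1r addr0 mulrzDr.
have -> : - (n.+1%:Z) = - n%:Z - 1 by rewrite intS; ring.
rewrite expgzB1 IHn -[(_ / _)%g]/(affine_mul _ (affine_inv _)).
by rewrite /affine_mul /affine_inv /= weight0 oppr0 weight0 !mul1r addr0 mulrzBr.
Qed.

End Affine.

Section GammaStructure.
Variables (r : nat) (p y : 'I_r -> nat).
Hypothesis p_gt0 : forall i, (0 < p i)%N.
Notation q := (fun i : 'I_r => p i ^ y i)%N.

Lemma q_gt0 i : (0 < q i)%N.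
Proof. by rewrite expn_gt0 p_gt0. Qed.

Definition affine_gen (o : option 'I_r) : affine q_gt0 :=
  if o is Some i then (0%R, unit_expo i) else (1%R, 0%R).

Lemma Gamma_affine :
  exists phi : UMagmaMorphism.type (Gamma p y) (affine q_gt0),
  phi (Gamma_a p y) = (1%R, 0%R) /\
  forall i, phi (Gamma_t p y i) = (0%R, unit_expo i).
Proof.
have [|phi phiE] := @pres_hom _ (Gamma_rel p y) (affine q_gt0) affine_gen.
  move=> _ _ [i j _|i]; rewrite ?wordvalX !wordvalM ?wordvalV !wordval_letter.
    by rewrite /= !affineM /= !mulr0 [(unit_expo i + _)%R]addrC.
  apply: (mulIg (affine_gen (Some i))); rewrite mulgVK.
  rewrite -[_ ^+ _]/(expgz (affine_gen None) (p i ^ y i)%N) affine_expgz.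
  rewrite !affineM /= weight_unit weight0 mulr1 mulr0 add0r addr0.
  by rewrite addr0 add0r.
by exists phi; split=> [|i]; rewrite phiE.
Qed.

Lemma Gamma_a_inj : injective (expgz (Gamma_a p y)).
Proof.
have [phi [phi_a _]] := Gamma_affine.
move=> z z' /(congr1 phi); rewrite !gmulf_expgz phi_a !affine_expgz.
by case=> /intr_inj.
Qed.

(** The exponent sums of the [t_i], read off the linear part of the affine
    model. *)
Lemma Gamma_exponents : exists e : Gamma p y -> {ffun 'I_r -> int},
  [/\ forall g h, e (g * h) = (e g + e h)%R, e 1 = 0%R,
      forall z, e (expgz (Gamma_a p y) z) = 0%R &
      forall i, e (Gamma_t p y i) = unit_expo i].
Proof.
have [phi [phi_a phi_t]] := Gamma_affine.
exists (fun g => (phi g).2); split=> [g h||z|i].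
- by rewrite gmulfM.
- by rewrite gmulf1.
- by rewrite gmulf_expgz phi_a affine_expgz.
- by rewrite phi_t.
Qed.

Lemma Gamma_t_comm i j : commute (Gamma_t p y i) (Gamma_t p y j).
Proof.
have [->//|ij] := eqVneq i j.
have := pres_rel (Gamma_rel_comm p y ij).
by rewrite !wordvalM !wordval_letter.
Qed.

Lemma Gamma_t_a i :
  Gamma_t p y i * Gamma_a p y = expgz (Gamma_a p y) (q i)%:Z * Gamma_t p y i.
Proof.
have := pres_rel (Gamma_rel_conj p y i).
rewrite wordvalX !wordvalM wordvalV !wordval_letter => e.
by rewrite -[expgz _ _]e mulgVK.
Qed.

End GammaStructure.

(** * The given generators of the subgroup *)

(** Moving the powers of [a] to the left, [g a^b] is [a^(N b) g] and [h a^c] is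
    [a^(M c) h]; the two products become powers of [a] times [g h] and [h g],
    with exponents [N b + N M c] and [M c + M N b]. *)
Lemma translation_commutator (G : groupType) (a g h : G) (N M : nat) (b c : int) :
    g * a = expgz a N * g -> h * a = expgz a M * h -> commute g h ->
  g * expgz a b * (h * expgz a c) =
  expgz a (b * N%:Z * (1 - M%:Z) - c * M%:Z * (1 - N%:Z))%R *
    (h * expgz a c * (g * expgz a b)).
Proof.
move=> ga ha gh.
have gz z : g * expgz a z = expgz a (N%:Z * z)%R * g.
  by rewrite expgzM; exact: expgz_conj.
have hz z : h * expgz a z = expgz a (M%:Z * z)%R * h.
  by rewrite expgzM; exact: expgz_conj.
rewrite !gz !hz -!mulgA [g * (_ * h)]mulgA gz [h * (_ * g)]mulgA hz.
rewrite -!mulgA -[h * g]gh !mulgA -!expgzD; congr (expgz a _ * _ * _); ring.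
Qed.

(** The weighted counts determine the number of occurrences of each letter one
    index at a time: in the equation of index [j] only letters [i <= j]
    contribute, and the letter [j] has the nonzero coefficient [k j j]. *)
Lemma perm_eq_triangular (r : nat) (k : 'I_r -> 'I_r -> nat) (u v : seq 'I_r) :
    (forall i, 0 < k i i)%N ->
    (forall j : 'I_r, \sum_(i <- u | (i <= j)%N) k i j =
                      \sum_(i <- v | (i <= j)%N) k i j)%N ->
  perm_eq u v.
Proof.
move=> k_gt0 uv; pose c w (i : 'I_r) := count_mem i w.
(* Regroup the sums over the words by letters, with multiplicities. *)
have sumE (w : seq 'I_r) (j : 'I_r) :
    (\sum_(i <- w | (i <= j)%N) k i j =
     \sum_(i < r | (i <= j)%N) c w i * k i j)%N.
  elim: w => [|i w IHw]; first by rewrite big_nil big1.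
  rewrite big_cons IHw; transitivity
    (\sum_(l < r | (l <= j)%N) ((i == l) * k l j + c w l * k l j))%N.
    rewrite big_split /=; case: ifP => ij.
      rewrite [X in (_ = X + _)%N](bigD1 i) //= eqxx mul1n.
      rewrite [X in (_ + X + _)%N]big1 ?addn0 // => l.
      by rewrite eq_sym => /andP [_ /negPf ->].
    rewrite [X in (_ = X + _)%N]big1 // => l lj.
    by case: eqP lj ij => // -> ->.
  by apply: eq_bigr => l _; rewrite /c /= mulnDl.
suff ceq n : forall i : 'I_r, (i < n)%N -> c u i = c v i.
  apply/allP => i _ /=; apply/eqP; exact: (ceq i.+1).
elim: n => // n IHn i; rewrite ltnS leq_eqVlt => /predU1P [i_n|]; last exact: IHn.
have := uv i; rewrite !sumE (bigD1 i) //= [in RHS](bigD1 i) //=.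
rewrite [X in (_ + X = _)%N](eq_bigr (fun l => c v l * k l i)%N) => [|l /andP [li nli]].
  by move/addIn/eqP; rewrite eqn_pmul2r // => /eqP.
by rewrite IHn // -i_n ltn_neqAle nli.
Qed.

Section Subgroup.
Variables (r : nat) (p y : 'I_r -> nat).
Hypothesis p_gt0 : forall i, (0 < p i)%N.
Variables (k : 'I_r -> 'I_r -> nat) (l : 'I_r -> int) (m : nat).
Hypothesis k_gt0 : forall i, (0 < k i i)%N.
Hypothesis m_gt0 : (0 < m)%N.
Notation a := (Gamma_a p y).
Notation t := (Gamma_t p y).

Definition tpart (i : 'I_r) : Gamma p y := \prod_(j < r | (i <= j)%N) t j ^+ k i j.
Definition xgen i : Gamma p y := tpart i * expgz a (l i).
Definition xexp (i : 'I_r) : nat :=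
  (\prod_(j < r | (i <= j)%N) p j ^ (y j * k i j))%N.

(** The elements [g] with [g a = a^N g] for some natural number [N] form a
    monoid, on which [N] is multiplicative, and each [t_j] belongs to it. *)
Lemma tpart_a i : tpart i * a = expgz a (xexp i) * tpart i.
Proof.
pose ok (g : Gamma p y) (N : nat) := g * a = expgz a N * g.
have okM g1 g2 N1 N2 : ok g1 N1 -> ok g2 N2 -> ok (g1 * g2) (N1 * N2)%N.
  move=> e1 e2; rewrite /ok -mulgA e2 mulgA (expgz_conj _ e1) -expgzM.
  by rewrite -PoszM -mulgA.
have okX g N n : ok g N -> ok (g ^+ n) (N ^ n)%N.
  move=> gN; elim: n => [|n IHn]; first by rewrite /ok mul1g mulg1.
  by rewrite expgS expnS; exact: okM.
apply: (big_rec2 ok) => [|j N g _ gN]; first by rewrite /ok mul1g mulg1.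
by apply: okM => //; rewrite expnM; apply: okX; exact: Gamma_t_a.
Qed.

Lemma tpart_comm i j : commute (tpart i) (tpart j).
Proof.
apply: commute_prod => j' _; apply/commute_sym/commute_prod => i' _.
exact/commuteX2/Gamma_t_comm.
Qed.

Lemma xgen_am i : xgen i * a ^+ m = expgz (a ^+ m) (xexp i) * xgen i.
Proof.
apply: esym; rewrite -[a ^+ m]/(expgz a m) -expgzM mulrC expgzM.
rewrite /xgen mulgA -(expgz_conj _ (tpart_a i)) -!mulgA.
by rewrite -!expgzD addrC.
Qed.

Definition xcomm i j : int :=
  (l i * (xexp i)%:Z * (1 - (xexp j)%:Z)
   - l j * (xexp j)%:Z * (1 - (xexp i)%:Z))%R.

Lemma xgen_xgen i j :
  xgen i * xgen j = expgz a (xcomm i j) * (xgen j * xgen i).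
Proof. exact: translation_commutator (tpart_a i) (tpart_a j) (tpart_comm i j). Qed.

(** Powers of [a] do not change the exponent sums of the [t_j], and the exponent
    sum of [t_j] in [xgen i] is [k i j] for [i <= j] and 0 otherwise. *)
Lemma pos_xgen_perm u v z :
  pos xgen u = expgz a z * pos xgen v -> perm_eq u v.
Proof.
have [e [eM e1 ea et]] := Gamma_exponents y p_gt0.
have e_prod I (s : seq I) (Q : pred I) F :
    e (\prod_(i <- s | Q i) F i) = (\sum_(i <- s | Q i) e (F i))%R.
  exact: (big_morph e eM e1).
have eX g n : e (g ^+ n) = (e g *+ n)%R.
  by elim: n => [|n IHn]; rewrite ?e1 // expgS eM IHn mulrS.
have e_x (i j : 'I_r) : e (xgen i) j = ((if (i <= j)%N then k i j else 0)%N%:Z)%R.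
  rewrite eM ea addr0 e_prod sum_ffunE.
  rewrite (eq_bigr (fun j' => ((j' == j) * k i j')%N%:Z%R)) => [|j' _]; last first.
    rewrite eX et ffunMnE ffunE; case: eqP => _; last by rewrite mul0rn mul0n.
    by rewrite mul1n; exact: natz.
  case: ifP => ij; last first.
    by rewrite big1 // => j' ij'; case: eqP ij' ij => // -> ->.
  by rewrite (bigD1 j) //= eqxx mul1n big1 ?addr0 // => j' /andP [_ /negPf ->].
have e_pos (w : seq 'I_r) (j : 'I_r) :
    e (pos xgen w) j = (\sum_(i <- w | (i <= j)%N) k i j)%N%:Z%R.
  rewrite e_prod sum_ffunE (eq_bigr _ (fun i _ => e_x i j)).
  rewrite -(big_morph Posz PoszD (erefl (0%:Z)%R)).
  by congr Posz; rewrite [RHS]big_mkcond.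
move=> uv; apply: (perm_eq_triangular k_gt0) => j.
move: (congr1 (fun g => e g j) uv); rewrite eM ea add0r !e_pos.
by case.
Qed.

Section Presentation.
Variable R : 'I_r -> 'I_r -> int.
Hypothesis R_char : forall i j, xcomm i j = (R i j * m%:Z)%R.

(** Injectivity: an element of the kernel is a fraction; comparing exponent sums
    makes it a conjugate of a power of [sub_al], and these powers embed. *)
Lemma sub_pres_embedding :
  exists phi : UMagmaMorphism.type (sub_pres xexp R) (Gamma p y),
  [/\ phi (sub_al xexp R) = a ^+ m, forall i, phi (sub_x xexp R i) = xgen i &
      injective phi].
Proof.
pose f (o : option 'I_r) := if o is Some i then xgen i else a ^+ m.
have [_ _ [i|i j]|phi phiE] := @pres_hom _ (sub_rel xexp R) (Gamma p y) f.
- rewrite wordvalX !wordvalM wordvalV !wordval_letter; apply: (mulIg (xgen i)).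
  by rewrite mulgVK; exact: xgen_am.
- rewrite wordval_expgz !wordvalM !wordvalV !wordval_letter -[f None]/(expgz a m).
  rewrite -expgzM mulrC -R_char; apply: (mulIg (xgen j * xgen i)).
  by rewrite /= -xgen_xgen mulgA !mulgVK.
have phi_al : phi (sub_al xexp R) = a ^+ m by exact: phiE.
have phi_x i : phi (sub_x xexp R i) = xgen i by exact: phiE.
exists phi; split=> //.
have phi_pos u : phi (pos (sub_x xexp R) u) = pos xgen u.
  by rewrite gmulf_prod; apply: eq_bigr => i _.
have phi_alz z : phi (expgz (sub_al xexp R) z) = expgz a (m%:Z * z)%R.
  by rewrite gmulf_expgz phi_al expgzM.
apply: gmulf_inj => g; have [u [z [v ->]]] := sub_fraction g => phi1.
have uv : perm_eq u v.
  apply: (@pos_xgen_perm u v (m%:Z * z)%R); apply: (mulgI (pos xgen u)^-1).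
  rewrite mulVg -phi1 /fraction !gmulfM gmulfV phi_alz !phi_pos.
  by rewrite mulgA.
have [d gd] := fraction_perm (@sub_x_al _ xexp R) (@sub_x_x _ xexp R) z uv.
move: phi1; rewrite gd !gmulfM gmulfV phi_alz !phi_pos => conj1.
have /(Gamma_a_inj p_gt0)/eqP : expgz a (m%:Z * d)%R = expgz a 0.
  apply: (mulgI (pos xgen v)^-1); apply: (mulIg (pos xgen v)).
  by rewrite conj1 mulg1 mulVg.
rewrite mulf_eq0 => /orP [|/eqP ->]; first by rewrite eqz_nat eqn0Ngt m_gt0.
by rewrite mulg1 mulVg.
Qed.

End Presentation.
End Subgroup.

Theorem theorem3p5 (n r : nat) (p y : 'I_r -> nat)
    (n_ge2 : (2 <= n)%N)
    (p_prime : forall i, prime (p i))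
    (p_inj : injective p)
    (y_gt0 : forall i, (0 < y i)%N)
    (n_dec : n = (\prod_(i < r) p i ^ y i)%N)
    (H : groupClosed (Gamma p y))
    (H_fin : finite_index H)
    (k : 'I_r -> 'I_r -> nat) (l : 'I_r -> int) (m : nat)
    (k_gt0 : forall i, (0 < k i i)%N)
    (m_gt0 : (0 < m)%N)
    (m_n : gcdn m n = 1%N)
    (H_gen : [set` H]%classic = generated
       ([set (\prod_(j < r | (i <= j)%N) Gamma_t p y j ^+ k i j)
               * expgz (Gamma_a p y) (l i) | i in [set: 'I_r]]
        `|` [set Gamma_a p y ^+ m])%classic%g)
    (H_a : ([set` H] `&` generated [set Gamma_a p y]
            = generated [set Gamma_a p y ^+ m])%classic%g) :
  let P (i : 'I_r) := (\prod_(j < r | (i <= j)%N) p j ^ (y j * k i j))%N in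
  let characterizes (R : 'I_r -> 'I_r -> int) := forall i j : 'I_r,
    (l i * (P i)%:Z * (1 - (P j)%:Z) - l j * (P j)%:Z * (1 - (P i)%:Z)
     = R i j * m%:Z)%R in
  (exists R, characterizes R) /\
  (forall R, characterizes R ->
     isomorphic (subgroup H) (presented (sub_rel P R))).
Proof.
move=> P characterizes.
have p_gt0 i : (0 < p i)%N := prime_gt0 (p_prime i).
split=> [|R R_char].
  have xH i : xgen p y k l i \in H.
    suff : [set` H] (xgen p y k l i) by [].
    by rewrite H_gen; apply: sub_gen_smallest; left; exists i.
  (* [a] raised to the commutator exponent lies in both [H] and [<a>]. *)
  exists (fun i j => (xcomm p y k l i j %/ m)%Z) => i j; apply/esym/divzK.
  have : generated [set Gamma_a p y ^+ m] (expgz (Gamma_a p y) (xcomm p y k l i j)).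
    rewrite -H_a; split; last exact: cycle_expgz.
    have := xgen_xgen p y k l i j => /(canLR (mulgK _)) /= <-.
    by apply: gpredF; apply: gpredM.
  case/expgz_cycle => d _; rewrite -[_ ^+ m]/(expgz (Gamma_a p y) m) -expgzM.
  by move=> /(Gamma_a_inj p_gt0) <-; rewrite dvdz_mulr.
have [phi [phi_al phi_x phi_inj]] := sub_pres_embedding p_gt0 k_gt0 m_gt0 R_char.
apply: (embedding_isomorphic phi_inj); rewrite H_gen range_pres_hom; congr generated.
apply/seteqP; split=> [_ [[i _ <-]|->]|_ [[i|] _ <-]].
- by exists (Some i) => //; exact: phi_x.
- by exists None => //; exact: phi_al.
- by left; exists i => //; apply: esym; exact: phi_x.
- by right; exact: phi_al.
Qed.
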